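(* Let $b\in\mathbb{R}$, let $1<\alpha<2$, and let ${f:{}_{b}\mathbb{N}\to\mathbb{R}}$ be a function such that ${}_{b}\Delta^{\alpha}f(u)\ge 0$ for all $u\in{}_{b-(2-\alpha)}\mathbb{N}$ and $f(b-1)\ge f(b)\ge 0$. Then $-\nabla f(t)\ge 0$ for all $t\in{}_{b}\mathbb{N}$.
   Context: For a real number $c$, ${}_{c}\mathbb{N}=\{c,c-1,c-2,\dots\}$. $\nabla f(t)=f(t)-f(t-1)$, $\nabla^m=\nabla(\nabla^{m-1})$, $\sigma(t)=t+1$. The falling function is $x^{(\beta)}=\Gamma(x+1)/\Gamma(x+1-\beta)$, with the convention that division at a pole yields zero. The delta right fractional sum of order $\beta>0$ ending at $b$ is ${}_{b}\Delta^{-\beta}f(t)=\frac{1}{\Gamma(\beta)}\sum_{s=t+\beta}^{b}(s-\sigma(t))^{(\beta-1)}f(s)$, $t\in{}_{b-\beta}\mathbb{N}$. For noninteger $\alpha>0$ and $n=[\alpha]+1$ (here $n=2$) the delta right (Riemann) fractional difference is ${}_{b}\Delta^{\alpha}f(t)=(-1)^n\nabla^n\,{}_{b}\Delta^{-(n-\alpha)}f(t)$, $t\in{}_{b-(n-\alpha)}\mathbb{N}$. *)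

(* Defs.v *)
From HB Require Import structures.
From mathcomp Require Import all_boot all_order all_algebra.
From mathcomp Require Import all_classical all_reals all_analysis.

Set Implicit Arguments.
Unset Strict Implicit.
Unset Printing Implicit Defensive.

Import Order.TTheory GRing.Theory Num.Theory.
Import numFieldNormedType.Exports.
Local Open Scope classical_set_scope.
Local Open Scope ring_scope.

(* {c, c - 1, c - 2, ...}; written _{c}N in the literature. *)
Definition down_grid {R : realType} (c : R) : set R :=
  [set t | exists k : nat, t = c - k%:R].

(* Functions on a grid are represented by total functions R -> R; the operators
   below, evaluated at a point of the relevant grid, only read grid values. *)
Definition nabla {R : realType} (f : R -> R) : R -> R :=
  fun t => f t - f (t - 1).

Definition nablan {R : realType} (m : nat) (f : R -> R) : R -> R :=
  iter m nabla f.

Definition sigma {R : realType} (t : R) : R := t + 1.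

(* The integral converges exactly for 0 < x. *)
Definition euler_integral {R : realType} (x : R) : R :=
  \int[lebesgue_measure]_(t in `]0%R, +oo[) (t `^ (x - 1) * expR (- t)).

(* Euler's integral for 0 < x (then n = 0), extended to the other reals by
   Gamma(x) = Gamma(x + n) / (x (x + 1) ... (x + n - 1)), with n the least
   natural number such that 0 < x + n.  At a pole x = 0, -1, -2, ... the product
   vanishes, so that Gamma(x) = 0 because division by zero is zero. *)
Definition Gamma {R : realType} (x : R) : R :=
  let n := Num.truncn (1 - x) in
  euler_integral (x + n%:R) / \prod_(i < n) (x + i%:R).

(* As Gamma is 0 at its poles and y / 0 = 0, this implements the convention that
   division at a pole yields zero. *)
Definition falling {R : realType} (x beta : R) : R :=
  Gamma (x + 1) / Gamma (x + 1 - beta).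

(* F(a) + F(a + 1) + ... over the points a + i <= b; empty when b < a. *)
Definition step_sum {R : realType} (a b : R) (F : R -> R) : R :=
  \sum_(0 <= i < Num.truncn (b - a + 1)) F (a + i%:R).

Definition right_frac_sum {R : realType} (b beta : R) (f : R -> R) : R -> R :=
  fun t => (Gamma beta)^-1 *
    step_sum (t + beta) b (fun s => falling (s - sigma t) (beta - 1) * f s).

(* Riemann right fractional difference, for noninteger 0 < alpha. *)
Definition right_frac_diff {R : realType} (b alpha : R) (f : R -> R) : R -> R :=
  let n := (Num.truncn alpha).+1 in
  fun t => (-1) ^+ n * nablan n (right_frac_sum b (n%:R - alpha) f) t.

(* Main.v *)
(** Put beta = 2 - alpha, g j = f (b - j), D 0 = g 0, D (j + 1) = g (j + 1) - g j
    and w i = Gamma (beta + i) / (Gamma beta * i!).  On the grid the fractional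
    sum is the convolution w * g, whose first difference is w * D, so the
    hypothesis says that w * D is nondecreasing from index 1 on.  As w is positive
    and nonincreasing, writing this as
      w 0 * D (k + 2) >= \sum_(i <= k + 1) (w i - w (i + 1)) * D (k + 1 - i)
    gives D >= 0 by strong induction from D 0 = f b and D 1 = f (b - 1) - f b.
    Monotonicity of w is w (i + 1) = w i * (beta + i) / (i + 1), that is, the
    functional equation of Gamma, obtained by integrating the derivative of
    t^x e^-t over [1/(n+1), n+2] and letting n tend to infinity. *)

Require Import Defs.
From HB Require Import structures.
From mathcomp Require Import all_boot all_order all_algebra.
From mathcomp Require Import all_classical all_reals all_analysis measurable_realfun.
From mathcomp Require Import lra ring.

Set Implicit Arguments.
Unset Strict Implicit.
Unset Printing Implicit Defensive.

Import Order.TTheory GRing.Theory Num.Theory.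
Import numFieldNormedType.Exports.
Local Open Scope classical_set_scope.
Local Open Scope ring_scope.

(** * Bounds and integrability of t^x e^-t *)

(* From u <= e^u at u = t / (2 x), raised to the power x. *)
Lemma powR_le_expR (R : realType) (x t : R) : 0 < x -> 0 <= t ->
  t `^ x <= (2 * x) `^ x * expR (t / 2).
Proof.
move=> x0 t0; have -> : t / 2 = t / (2 * x) * x by field; rewrite gt_eqF.
rewrite expRM -powRM ?expR_ge0//; last by lra.
have le_arg : t <= 2 * x * expR (t / (2 * x)).
  rewrite -ler_pdivrMl ?mulr_gt0// mulrC (le_trans _ (expR_ge1Dx _))//; lra.
by apply: ge0_ler_powR => //; rewrite ?nnegrE ?mulr_ge0 ?expR_ge0 ?ltW.
Qed.

(** Half of the exponential decay absorbs the power; the other half serves both as an integrable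
    majorant and for the limit at infinity. *)
Lemma powR_expRN_le (R : realType) (x t : R) : 0 < x -> 0 <= t ->
  t `^ x * expR (- t) <= (2 * x) `^ x * expR (- (t / 2)).
Proof.
move=> x0 t0; have -> : expR (- (t / 2)) = expR (t / 2) * expR (- t).
  by rewrite -expRD; congr expR; lra.
by rewrite mulrA ler_wpM2r ?expR_ge0 ?powR_le_expR.
Qed.

Lemma measurable_powR_expRN (R : realType) (x : R) (A : set R) :
  measurable_fun A (fun t => t `^ x * expR (- t)).
Proof.
apply: measurable_funTS; apply: measurable_funM; first exact: measurable_powR.
by apply: measurableT_comp => //; exact: measurable_expR.
Qed.

Lemma integrable_powR_expRN (R : realType) (x : R) : 0 < x ->
  (@lebesgue_measure R).-integrable `]0%R, +oo[
    (EFin \o (fun t => t `^ x * expR (- t))).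
Proof.
(* The majorant is a multiple of the exponential density of rate 1/2; the factor 2 in [C] cancels
   that rate. *)
move=> x0; pose C : R := 2 * (2 * x) `^ x.
have iC : (@lebesgue_measure R).-integrable `]0%R, +oo[
    (fun t => C%:E * (exponential_pdf 2^-1 t)%:E)%E.
  by apply: integrableZl => //; apply: integrableS (integrable_exponential_pdf _).
apply: le_integrable iC => //.
- by apply/measurable_EFinP; exact: measurable_powR_expRN.
- move=> t /=; rewrite in_itv/= andbT => t0.
  rewrite (exponential_pdfE _ (ltW t0)) lee_fin.
  rewrite !ger0_norm ?mulr_ge0 ?powR_ge0 ?expR_ge0//.
  apply: le_trans (powR_expRN_le x0 (ltW t0)) _.
  have -> : - 2^-1 * t = - (t / 2) by ring.
  by rewrite /C mulrACA divff// mul1r.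
Qed.

(** * Functional equation of Euler's integral *)

Lemma is_derive_powR_expRN (R : realType) (x t : R) : 0 < t ->
  is_derive t 1 (fun t => t `^ x * expR (- t))
    (x * (t `^ (x - 1) * expR (- t)) - t `^ x * expR (- t)).
Proof.
move=> t0; have h := is_derive1_powR x t0.
apply: is_derive_eq; rewrite /GRing.scale /=; ring.
Qed.

Lemma continuous_powR_expRN (R : realType) (x t : R) : 0 < t ->
  {for t, continuous (fun t => t `^ x * expR (- t))}.
Proof.
move=> t0; apply/differentiable_continuous/derivable1_diffP.
by have [] := is_derive_powR_expRN x t0.
Qed.

Lemma within_continuous_powR_expRN (R : realType) (x a b : R) : 0 < a ->
  {within `[a, b], continuous (fun t => t `^ x * expR (- t))}.
Proof.
move=> a0; apply: derivable_within_continuous => t; rewrite in_itv/= => /andP[at_ _].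
by have [] := is_derive_powR_expRN x (lt_le_trans a0 at_).
Qed.

Lemma integrable_powR_expRN_segment (R : realType) (x a b : R) : 0 < a ->
  (@lebesgue_measure R).-integrable `[a, b]
    (EFin \o (fun t => t `^ x * expR (- t))).
Proof.
move=> a0; apply: continuous_compact_integrable; first exact: segment_compact.
exact: within_continuous_powR_expRN.
Qed.

(** Integration by parts on a segment away from 0, where t^(x - 1) is continuous even if its
    exponent is negative. *)
Lemma Rintegral_powR_expRN_segment (R : realType) (x a b : R) : 0 < a -> a < b ->
  let I y := \int[@lebesgue_measure R]_(t in `[a, b]) (t `^ y * expR (- t)) in
  x * I (x - 1) = I x + (b `^ x * expR (- b) - a `^ x * expR (- a)).
Proof.
move=> a0 ab I.
have i1 := integrable_powR_expRN_segment (x - 1) b a0.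
have i2 := integrable_powR_expRN_segment x b a0.
have ftc : \int[@lebesgue_measure R]_(t in `[a, b])
    (x * (t `^ (x - 1) * expR (- t)) - t `^ x * expR (- t)) =
    b `^ x * expR (- b) - a `^ x * expR (- a).
  rewrite /Rintegral (@continuous_FTC2 _ _ (fun t => t `^ x * expR (- t)))//.
  - move=> t; apply: cvgB; first apply: cvgMr.
      exact: within_continuous_powR_expRN.
    exact: within_continuous_powR_expRN.
  - split.
    + move=> t; rewrite in_itv/= => /andP[at_ _].
      by have [] := is_derive_powR_expRN x (lt_trans a0 at_).
    + by apply: cvg_at_right_filter; exact: continuous_powR_expRN.
    + by apply: cvg_at_left_filter; apply: continuous_powR_expRN; exact: lt_trans ab.
  - move=> t; rewrite in_itv/= => /andP[at_ _].
    by rewrite derive1E; have [_ ->] := is_derive_powR_expRN x (lt_trans a0 at_).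
move: ftc; rewrite RintegralB//; last first.
  by apply: eq_integrable (integrableZl _ x i1).
by rewrite RintegralZl// => <-; rewrite [RHS]addrC subrK.
Qed.

Lemma cvg_powR_expRN_pinfty (R : realType) (x : R) : 0 < x ->
  t `^ x * expR (- t) @[t --> +oo] --> 0.
Proof.
move=> x0; apply: (@squeeze_cvgr _ _ _ _ (cst 0)
    (fun t => (2 * x) `^ x * expR (- (t / 2)))).
- near=> t; rewrite mulr_ge0 ?powR_ge0 ?expR_ge0//=.
  by apply: powR_expRN_le.
- exact: cvg_cst.
- rewrite -[0](mulr0 ((2 * x) `^ x)); apply: cvgMr => //.
  apply: (@cvg_comp _ _ _ (fun t => t / 2) (fun t => expR (- t)) _ (pinfty_nbhs R)).
    exact: gt0_cvgMly.
  exact: cvgr_expR.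
Unshelve. all: by end_near. Qed.

Lemma cvg_powR_expRN_at0 (R : realType) (x : R) : 0 < x ->
  t `^ x * expR (- t) @[t --> 0^'+] --> 0.
Proof.
move=> x0; apply: (@squeeze_cvgr _ _ _ _ (cst 0) (fun t => t `^ x)).
- near=> t; rewrite mulr_ge0 ?powR_ge0 ?expR_ge0//=.
  by rewrite ler_piMr ?powR_ge0// expR_le1 oppr_le0.
- exact: cvg_cst.
- exact: powR_cvg0.
Unshelve. all: by end_near. Qed.

(** Monotone convergence along increasing segments. The limit lives in the extended reals, so it
    applies before the integral is known to be finite. *)
Lemma cvg_integral_exhaustion (R : realType) (f : R -> R) :
  measurable_fun setT f -> (forall t, 0 <= f t) ->
  (\int[@lebesgue_measure R]_(t in `[n.+1%:R^-1%R : R, n.+2%:R%R]) (f t)%:E)%E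
    @[n --> \oo] --> (\int[@lebesgue_measure R]_(t in `]0%R, +oo[) (f t)%:E)%E.
Proof.
move=> mf f0; have -> : `]0%R, +oo[%classic =
    \bigcup_n `[n.+1%:R^-1%R : R, n.+2%:R%R]%classic.
  apply/seteqP; split => t /=; rewrite in_itv/= ?andbT.
    (* The index must be large enough for both t <= n + 2 and 1/t <= n + 1. *)
    move=> t0; exists (maxn (Num.truncn t) (Num.truncn t^-1)) => //=.
    rewrite in_itv/=; apply/andP; split.
      rewrite invf_ple ?posrE//; apply: le_trans (ltW (truncnS_gt _)) _.
      by rewrite ler_nat ltnS leq_maxr.
    apply: le_trans (ltW (truncnS_gt _)) _.
    by rewrite ler_nat ltnW// !ltnS leq_maxl.
  by move=> [n _] /=; rewrite in_itv/= => /andP[+ _]; apply: lt_le_trans.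
apply: ge0_nondecreasing_set_cvg_integral => //.
- move=> m n mn; rewrite subsetEset; apply: subset_itv.
    by rewrite bnd_simp lef_pV2 ?posrE// ler_nat.
  by rewrite bnd_simp ler_nat !ltnS.
- move=> n; apply/measurable_EFinP; exact: measurable_funTS.
- by move=> n x _; rewrite lee_fin.
Qed.

(* Only convergence of the integral at x + 1 is used: the limit also gives
   convergence at x, where for x < 1 the integrand is unbounded near 0. *)
Lemma euler_integralE (R : realType) (x : R) : 0 < x ->
  euler_integral x = euler_integral (x + 1) / x.
Proof.
move=> x0; rewrite {1}/euler_integral.
pose I y n := \int[@lebesgue_measure R]_(t in `[n.+1%:R^-1%R : R, n.+2%:R%R])
  (t `^ y * expR (- t)).
have IE y n : (\int[@lebesgue_measure R]_(t in `[n.+1%:R^-1%R : R, n.+2%:R%R])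
    (t `^ y * expR (- t))%:E)%E = (I y n)%:E.
  rewrite fineK//; apply: integrable_fin_num => //.
  by apply: integrable_powR_expRN_segment; rewrite invr_gt0.
have cvgI y := cvg_integral_exhaustion (@measurable_powR_expRN R y setT)
   (fun t => mulr_ge0 (powR_ge0 t y) (expR_ge0 (- t))).
have limI : I x n @[n --> \oo] --> euler_integral (x + 1).
  move: (cvgI x); under eq_fun do rewrite IE.
  rewrite /euler_integral addrK -[X in _ --> X]fineK//; last first.
    apply: integrable_fin_num => //; exact: integrable_powR_expRN.
  by move/fine_cvg.
have lim1 : n.+2%:R `^ x * expR (- n.+2%:R) @[n --> \oo] --> (0 : R).
  move/cvg_pinftyP : (cvg_powR_expRN_pinfty x0); apply.
  by have := @cvgr_idn R; rewrite -(cvg_shiftn 2); under eq_fun do rewrite addn2.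
have lim2 : n.+1%:R^-1 `^ x * expR (- n.+1%:R^-1) @[n --> \oo] --> (0 : R).
  move/cvg_at_rightP : (cvg_powR_expRN_at0 x0); apply; split; last exact: cvg_harmonic.
  by move=> n; rewrite invr_gt0.
have limJ : I (x - 1) n @[n --> \oo] --> euler_integral (x + 1) / x.
  have -> : I (x - 1) = fun n => (I x n + (n.+2%:R `^ x * expR (- n.+2%:R) -
       n.+1%:R^-1 `^ x * expR (- n.+1%:R^-1))) / x.
    apply/funext => n; rewrite -Rintegral_powR_expRN_segment//.
      by rewrite mulrC mulKf// gt_eqF.
    by rewrite (@le_lt_trans _ _ 1) ?invf_le1 ?ler1n ?ltr1n.
  have -> : euler_integral (x + 1) / x = (euler_integral (x + 1) + (0 - 0)) / x.
    by rewrite subr0 addr0.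
  by apply: cvgMl; apply: cvgD limI _; exact: cvgB.
rewrite /Rintegral; suff -> : (\int[@lebesgue_measure R]_(t in `]0%R, +oo[)
    (t `^ (x - 1) * expR (- t))%:E)%E = (euler_integral (x + 1) / x)%:E by [].
apply: (cvg_unique _ (cvgI (x - 1))) => //.
rewrite /=; under eq_fun do rewrite IE.
by apply/cvg_EFin => //; exact: nearW.
Qed.

(** * Discrete convolutions *)

Lemma nonneg_of_convolution_nondecreasing (R : realFieldType) (w D : nat -> R) :
  0 < w 0 -> (forall i, w i.+1 <= w i) -> 0 <= D 0 -> 0 <= D 1 ->
  (forall k, \sum_(i < k.+2) w i * D (k.+1 - i)%N <=
             \sum_(i < k.+3) w i * D (k.+2 - i)%N) ->
  forall m, 0 <= D m.
Proof.
move=> w0 wle D0 D1 H; elim/ltn_ind => -[|[|k]] // IH.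
rewrite -(pmulr_rge0 _ w0); move: (H k).
(* Once the term i = 0 of the longer sum is isolated, the shifted remainder pairs with the shorter
   sum, the same value of [D] carrying the coefficient w i - w (i + 1). *)
rewrite [leRHS]big_ord_recl subn0 -lerBlDr -sumrB; apply: le_trans.
apply: sumr_ge0 => i _; rewrite subSS -mulrBl mulr_ge0//; first by rewrite subr_ge0 wle.
by apply: IH; rewrite ltnS leq_subr.
Qed.

(** The convention D 0 = g 0 amounts to extending [g] by 0 to index -1, which accounts for the last
    term of the longer sum. *)
Lemma sum_convolution_diff (R : realFieldType) (w g D : nat -> R) (m : nat) :
  D 0 = g 0 -> (forall j, D j.+1 = g j.+1 - g j) ->
  \sum_(i < m.+2) w i * D (m.+1 - i)%N =
  \sum_(i < m.+2) w i * g (m.+1 - i)%N - \sum_(i < m.+1) w i * g (m - i)%N.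
Proof.
move=> D0 DS; rewrite big_ord_recr [X in _ = X - _]big_ord_recr/= subnn D0 addrAC.
rewrite -sumrB; congr (_ + _); apply: eq_bigr => i _.
by rewrite -mulrBr subSn ?DS// -ltnS.
Qed.

(** * Gamma at positive arguments and the fractional operators on the grid *)

Lemma Gamma_gt0E (R : realType) (x : R) : 0 < x -> Gamma x = euler_integral x.
Proof.
move=> x0; rewrite /Gamma; have -> : Num.truncn (1 - x) = 0%N.
  by apply/truncn0Pn; rewrite -ltNge; lra.
by rewrite addr0 big_ord0 divr1.
Qed.

Lemma right_frac_sum_grid (R : realType) (b beta : R) (f : R -> R) (k : nat) :
  right_frac_sum b beta f (b - beta - k%:R) =
  \sum_(i < k.+1) ((Gamma beta)^-1 * (Gamma (beta + i%:R) / Gamma i.+1%:R)) *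
     f (b - (k - i)%N%:R).
Proof.
rewrite /right_frac_sum /step_sum.
(* The range of summation has exactly k + 1 points s = b - (k - i), and s - t = beta + i there. *)
have -> : b - (b - beta - k%:R + beta) + 1 = k.+1%:R :> R.
  by rewrite -natr1; ring.
rewrite natrK big_mkord mulr_sumr; apply: eq_bigr => i _.
rewrite -mulrA /falling /sigma -natr1 natrB -1?ltnS//.
have -> : b - beta - k%:R + beta + i%:R = b - (k%:R - i%:R) by ring.
have -> : b - (k%:R - i%:R) - (b - beta - k%:R + 1) + 1 - (beta - 1) = i%:R + 1 by ring.
by have -> : b - (k%:R - i%:R) - (b - beta - k%:R + 1) + 1 = beta + i%:R by ring.
Qed.

Lemma right_frac_diff_grid (R : realType) (b alpha : R) (f : R -> R) (k : nat) :
  1 < alpha -> alpha < 2 ->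
  let G j := right_frac_sum b (2 - alpha) f (b - (2 - alpha) - j%:R) in
  right_frac_diff b alpha f (b - (2 - alpha) - k%:R) =
  (G k.+2 - G k.+1) - (G k.+1 - G k).
Proof.
move=> a1 a2 G; rewrite /right_frac_diff.
(* So n = 2 and the sign is +1; each [nabla] steps down the grid, that is, raises the index by
   one. *)
have -> : Num.truncn alpha = 1%N by apply: truncn_def; lra.
rewrite /nablan /= /nabla sqrrN expr1n mul1r.
have GS j : b - (2 - alpha) - j%:R - 1 = b - (2 - alpha) - j.+1%:R.
  by rewrite -natr1; ring.
by rewrite !GS -!/(G _); ring.
Qed.

(** * Positivity of Gamma and monotonicity of the weights *)

Lemma euler_integral_gt0 (R : realType) (x : R) : 0 < x -> 0 < euler_integral x.
Proof.
(* Passing to x + 1 makes the exponent positive: the integrand is then integrable, and on [1, 2] it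
   is at least e^-2 because t^x >= 1. *)
move=> x0; rewrite euler_integralE// divr_gt0// /euler_integral addrK.
apply: (@lt_le_trans _ _ (expR (- 2))); first exact: expR_gt0.
rewrite /Rintegral -lee_fin fineK; last first.
  by apply: integrable_fin_num => //; exact: integrable_powR_expRN.
apply: (@le_trans _ _ (\int[@lebesgue_measure R]_(t in `[1%R, 2%R])
    (t `^ x * expR (- t))%:E)%E); last first.
  apply: ge0_subset_integral => //.
  - by apply/measurable_EFinP; exact: measurable_powR_expRN.
  - by move=> t _; rewrite lee_fin mulr_ge0 ?powR_ge0 ?expR_ge0.
  - by move=> t /=; rewrite !in_itv/= andbT => /andP[+ _]; apply: lt_le_trans.
have -> : (expR (- 2))%:E =
    (\int[@lebesgue_measure R]_(t in `[1%R, 2%R]) (cst (expR (- 2))%:E t))%E.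
  rewrite integral_cst//= lebesgue_measure_itv/= lte_fin ltr1n -EFinB.
  have -> : 2 - 1 = 1 :> R by lra.
  by rewrite mule1.
apply: ge0_le_integral => //.
- by move=> t _; rewrite lee_fin expR_ge0.
- by apply/measurable_EFinP; exact: measurable_powR_expRN.
move=> t /=; rewrite in_itv/= => /andP[t1 t2]; rewrite lee_fin -[leLHS]mul1r.
rewrite ler_pM ?expR_ge0 ?ler_expR ?lerN2//.
by rewrite -(powRr0 t) ler_powR// ltW.
Qed.

Lemma Gamma_gt0 (R : realType) (x : R) : 0 < x -> 0 < Gamma x.
Proof. by move=> x0; rewrite Gamma_gt0E// euler_integral_gt0. Qed.

Lemma GammaD1 (R : realType) (x : R) : 0 < x -> Gamma (x + 1) = x * Gamma x.
Proof.
move=> x0; rewrite !Gamma_gt0E ?addr_gt0// (euler_integralE x0).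
by rewrite mulrC divfK// gt_eqF.
Qed.

Lemma Gamma_ratio_nonincreasing (R : realType) (beta : R) (i : nat) :
  0 < beta <= 1 ->
  Gamma (beta + i.+1%:R) / Gamma i.+2%:R <= Gamma (beta + i%:R) / Gamma i.+1%:R.
Proof.
move=> /andP[b0 b1]; have bi : 0 < beta + i%:R by rewrite ltr_wpDr.
have i0 : 0 < i.+1%:R :> R by [].
have -> : beta + i.+1%:R = beta + i%:R + 1 by rewrite -natr1 addrA.
rewrite -(natr1 i.+1) !GammaD1// invfM mulrACA.
rewrite ler_piMl//; first by rewrite ltW// divr_gt0// Gamma_gt0.
by rewrite ler_pdivrMr// mul1r -natr1 addrC lerD2l.
Qed.

Theorem theorem4p1 (R : realType) (b alpha : R) (f : R -> R) :
  1 < alpha -> alpha < 2 ->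
  (forall u : R, down_grid (b - (2 - alpha)) u -> 0 <= right_frac_diff b alpha f u) ->
  f b <= f (b - 1) -> 0 <= f b ->
  forall t : R, down_grid b t -> 0 <= - nabla f t.
Proof.
move=> a1 a2 diff_ge0 fb1 fb0 _ [k ->].
pose beta := 2 - alpha; have beta01 : 0 < beta <= 1 by rewrite /beta; lra.
have /andP[beta0 _] := beta01.
pose w i := (Gamma beta)^-1 * (Gamma (beta + i%:R) / Gamma i.+1%:R).
pose g j := f (b - j%:R).
pose D j := if j is j'.+1 then g j - g j' else g 0%N.
have wS i : w i.+1 <= w i.
  by rewrite ler_pM2l ?invr_gt0 ?Gamma_gt0// Gamma_ratio_nonincreasing.
have w0 : 0 < w 0%N.
  by rewrite /w addr0 mulr_gt0 ?invr_gt0 ?Gamma_gt0// divr_gt0// Gamma_gt0.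
have D_ge0 : forall m, 0 <= D m.
  apply: (nonneg_of_convolution_nondecreasing w0 wS).
  - by rewrite /D /g subr0.
  - by rewrite subr_ge0 /g mulr0n subr0.
  (* The increment of w * D from index m + 1 to m + 2 is the second difference of w * g, hence the
     fractional difference at b - beta - m. *)
  move=> m; rewrite !(@sum_convolution_diff _ w g D)// -subr_ge0.
  have := diff_ge0 _ (ex_intro _ m erefl).
  by rewrite right_frac_diff_grid// !right_frac_sum_grid.
(* At t = b - k the quantity - nabla f t is D (k + 1). *)
have := D_ge0 k.+1; rewrite /D /g /nabla opprB.
by have -> : b - k%:R - 1 = b - k.+1%:R by rewrite -natr1; ring.
Qed.
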